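(* Let $R$ be a ring and let $D$ be a subring of $R$ which is a UFD. Let $\alpha=|U(R)\cap \mathrm{Irr}(D)|$. Then $R$ has at least $\alpha$ maximal subrings up to $D$-algebra isomorphism.
   Context: All rings are commutative with $1\neq 0$; subrings and homomorphisms are unital. $U(R)$ is the set of units of $R$. $\mathrm{Irr}(D)$ denotes the set of all non-associate irreducible elements of the integral domain $D$ (i.e. a set containing exactly one representative of each associate class of irreducible elements). A proper subring $S$ of $R$ is a maximal subring of $R$ if it is maximal with respect to inclusion among the proper subrings of $R$. For rings $S,T$ containing $D$ as a subring, a $D$-algebra isomorphism $S\to T$ is a ring isomorphism that restricts to the identity on $D$. ''At least $\alpha$ maximal subrings up to $D$-algebra isomorphism'' means at least $\alpha$ maximal subrings of $R$ containing $D$, no two of which are isomorphic as $D$-algebras. *)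

(* Defs.v *)
From HB Require Import structures.
From mathcomp Require Import all_boot all_order all_algebra.
From mathcomp Require Import boolp classical_sets functions cardinality.

Set Implicit Arguments.
Unset Strict Implicit.
Unset Printing Implicit Defensive.

Import GRing.Theory.
Local Open Scope classical_set_scope.
Local Open Scope ring_scope.

(* Subrings of R are represented by classical subsets of R; all notions below
   are relative to such a subset, so U(R) is [units_of [set: R]]. *)
Section Subrings.
Variable R : comNzRingType.
Implicit Types (D S T I : set R) (x y p q : R).

Definition is_subring S : Prop := subring_closed (mem S).

Definition maximal_subring S : Prop :=
  [/\ is_subring S, S != [set: R] &
      forall T, is_subring T -> T != [set: R] -> S `<=` T -> T = S].

Definition units_of S : set R :=
  [set x | x \in S /\ exists2 y, y \in S & x * y = 1].

Definition integral_subring D : Prop :=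
  {in D &, forall x y, x * y = 0 -> x = 0 \/ y = 0}.

Definition associate D x y : Prop :=
  exists2 u, u \in units_of D & y = u * x.

Definition irreducibles D : set R :=
  [set p | [/\ p \in D, p != 0, p \notin units_of D &
     {in D &, forall x y, p = x * y -> x \in units_of D \/ y \in units_of D}]].

Definition is_UFD D : Prop :=
  [/\ is_subring D,
      integral_subring D,
      (forall x, x \in D -> x != 0 -> x \notin units_of D ->
         exists2 s : seq R, {subset s <= irreducibles D} & x = \prod_(p <- s) p)
    & (forall s t : seq R,
         {subset s <= irreducibles D} -> {subset t <= irreducibles D} ->
         \prod_(p <- s) p = \prod_(p <- t) p ->
         exists t' : seq R,
           [/\ perm_eq t t', size s = size t' &
               forall i, (i < size s)%N -> associate D s`_i t'`_i])].

(* I is a possible choice of Irr(D): it contains exactly one representative of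
   each associate class of irreducible elements of D. *)
Definition is_Irr D I : Prop :=
  I `<=` irreducibles D /\
  forall p, p \in irreducibles D -> exists! q, q \in I /\ associate D p q.

(* Only the values of f on S matter: every map S -> T is the restriction of
   some f : R -> R. *)
Definition alg_isomorphic D S T : Prop :=
  exists f : R -> R,
    [/\ set_bij S T f,
        {in S &, {morph f : x y / x + y}},
        {in S &, {morph f : x y / x * y}},
        f 1 = 1
      & {in D, f =1 id}].

End Subrings.

(* Main.v *)
(* Let p be an irreducible element of D with an inverse u in R.  By Zorn's lemma
   there is a maximal subring E containing D in which p is prime, the powers of
   (p) intersect in 0, and pE meets D in pD; the order on such subrings is
   inclusion with purity, E <= F iff pF meets E in pE, which is what makes the
   intersection condition pass to unions of chains.  If some x in R were
   transcendental over E, then by Gauss' lemma E[x] would contradict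
   maximality; so R is algebraic over E.  Let S be the set of elements integral
   over the localization of E at p.  It is a subring which does not contain u,
   but R = S[u] by algebraicity; so a subring maximal among those that contain S
   and avoid u is a maximal subring M_p of R.  The inverse of any q in Irr(D)
   other than p lies in M_p as soon as q is a unit of R, whereas 1/p does not;
   since a D-algebra isomorphism preserves inverses of elements of D, the
   subrings M_p are pairwise non-isomorphic. *)
Require Import Defs.
From HB Require Import structures.
From mathcomp Require Import all_boot all_order all_algebra.
From mathcomp Require Import boolp classical_sets functions cardinality.
From mathcomp Require Import ring.

Set Implicit Arguments.
Unset Strict Implicit.
Unset Printing Implicit Defensive.

Import GRing.Theory.
Local Open Scope classical_set_scope.
Local Open Scope ring_scope.

(** * Integrality and prime elements relative to a subring *)

Definition subring_pred (R : comNzRingType) (E : set R) (hE : is_subring E) :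
    subringClosed R :=
  HB.pack (fun x : R => x \in E)
    (GRing.isSubringClosed.Build R (fun x : R => x \in E) hE).

(** A genuine ring is needed here because [integralOver] speaks of a ring morphism, namely [val]. *)
Definition subring_type (R : comNzRingType) (E : subringClosed R) :=
  {x : R | x \in E}.
HB.instance Definition _ R E := SubChoice.on (@subring_type R E).
HB.instance Definition _ R E :=
  [SubChoice_isSubComNzRing of @subring_type R E by <:].

Section SubringPredicates.
Variable R : comNzRingType.
Implicit Types (E F : subringClosed R) (u c r x y : R).

Definition integral_over E x := integralOver (val : subring_type E -> R) x.

Lemma integral_overP E x :
  integral_over E x <->
  exists f : {poly R}, [/\ f \is monic, f \is a polyOver E & root f x].
Proof.
split=> [[f fmon fx]|[f [fmon /polyOverP fE fx]]].
  exists (map_poly val f); split=> //; first exact: monic_map.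
  by apply/polyOverP => i; rewrite coef_map; apply: valP.
pose g : {poly subring_type E} := \poly_(i < size f) Sub f`_i (fE i).
have gE : map_poly val g = f.
  apply/polyP => i; rewrite coef_map coef_poly.
  by case: ltnP => [_|/(nth_default 0)->] //=; rewrite SubK.
exists g; last by rewrite gE.
apply/eqP/val_inj; rewrite -lead_coef_map_inj ?gE ?(monicP fmon) //; apply: val_inj.
Qed.

(* A nonzero equation of [x] with leading coefficient [c], multiplied by a
   power of [c], becomes a monic equation of [c * x]. *)
Lemma integral_over_lead_coef E (f : {poly R}) x :
  f \is a polyOver E -> (1 < size f)%N -> root f x ->
  integral_over E (lead_coef f * x).
Proof.
move=> /polyOverP fE fs /rootP fx; set c := lead_coef f.
have cE : c \in E by apply: fE.
case fm : (size f) fs => [|[|m]] // _.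
pose h := \poly_(i < m.+1) (c ^+ (m - i) * f`_i).
pose g := 'X^(m.+1) + h.
have lts : (size h < size ('X^(m.+1) : {poly R}))%N.
  by rewrite size_polyXn ltnS size_poly.
apply/integral_overP; exists g; split.
- by rewrite monicE lead_coefDl // lead_coefXn.
- apply: rpredD; first by rewrite rpredX // polyOverX.
  by apply: polyOver_poly => i _; rewrite rpredM // rpredX.
apply/rootP; rewrite hornerD hornerXn horner_poly.
transitivity (c ^+ m * f.[x]); last by rewrite fx mulr0.
rewrite horner_coef fm [in RHS]big_ord_recr /= addrC mulrDr mulr_sumr; congr (_ + _).
  have -> : f`_m.+1 = c by rewrite /c lead_coefE fm.
  by rewrite exprMn exprSr; ring.
apply: eq_bigr => -[i im] _ /=; rewrite exprMn.
by rewrite -[in RHS](@subnK i m) // exprD; ring.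
Qed.

(* With [u = 1 / p], membership [u * a \in E] says that [p] divides [a] in [E]:
   thus [p] is a prime of [E], and no nonzero element of [E] is divisible by
   all the powers of [p]. *)
Definition separated_prime u E : Prop :=
  [/\ u \notin E,
      {in E &, forall a b, u * (a * b) \in E -> u * a \in E \/ u * b \in E}
    & {in E, forall a, (forall n, u ^+ n * a \in E) -> a = 0}].

(* With [u = 1 / p]: [E] is contained in [F] and [p F] meets [E] in [p E]. *)
Definition pure_in u E F : Prop :=
  {subset E <= F} /\ {in E, forall a, u * a \in F -> u * a \in E}.

Lemma separated_prime_expn u E : separated_prime u E ->
  forall c n, c \in E -> u * c \notin E -> u * c ^+ n \notin E.
Proof.
move=> [uE prE _] c n cE ucE; elim: n => [|n IHn]; first by rewrite expr0 mulr1.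
by rewrite exprS; apply/negP => /(prE _ _ cE (rpredX n cE)) []; apply/negP.
Qed.

(* Gauss' lemma: look at the product of the first coefficients of [f] and [g]
   that are not divisible by [p]. *)
Lemma separated_prime_poly u E (f g : {poly R}) : separated_prime u E ->
  f \is a polyOver E -> g \is a polyOver E -> u *: (f * g) \is a polyOver E ->
  u *: f \is a polyOver E \/ u *: g \is a polyOver E.
Proof.
move=> [_ prE _] /polyOverP fE /polyOverP gE /polyOverP fgE.
have first_coef (h : {poly R}) : u *: h \is a polyOver E \/
    exists i, u * h`_i \notin E /\ forall j, (j < i)%N -> u * h`_j \in E.
  have [hE|/existsNP[i hi]] := pselect (forall i, u * h`_i \in E).
    by left; apply/polyOverP => i; rewrite coefZ.
  have exi : exists i, u * h`_i \notin E by exists i; apply/negP.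
  right; case: (ex_minnP exi) => k hk kmin; exists k; split=> // j.
  by apply: contraTT => /kmin; rewrite -leqNgt.
have [|[i [fi ltfi]]] := first_coef f; first by left.
have [|[j [gj ltgj]]] := first_coef g; first by right.
have: u * (f`_i * g`_j) \in E.
  have lti : (i < (i + j).+1)%N by rewrite ltnS leq_addr.
  have := fgE (i + j)%N; rewrite coefZ coefM (bigD1 (Ordinal lti)) //=.
  rewrite addKn mulrDr rpredDr // mulr_sumr rpred_sum // => -[k /= kij].
  rewrite -val_eqE /= neq_ltn => /orP[ki|ik].
    by rewrite mulrA rpredM // ltfi.
  by rewrite mulrCA rpredM // ltgj // ltn_subLR // ltn_add2r.
by case/(prE _ _ (fE i) (gE j)) => [fi'|gj']; [rewrite fi' in fi|rewrite gj' in gj].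
Qed.

(** * Adjoining a transcendental element *)

Definition adjoin E x : set R :=
  [set r | exists2 f : {poly R}, f \is a polyOver E & r = f.[x]].

Lemma adjoin_subring E x : is_subring (adjoin E x).
Proof.
split=> [|r s|r s]; rewrite ?inE.
- by exists 1; rewrite ?rpred1 // hornerC.
- move=> [f fE ->] [g gE ->].
  by exists (f - g); rewrite ?rpredB // hornerD hornerN.
- move=> [f fE ->] [g gE ->].
  by exists (f * g); rewrite ?rpredM // hornerM.
Qed.

Section Transcendental.
Variables (p u : R) (E : subringClosed R) (x : R).
Hypotheses (pu : p * u = 1) (pE : p \in E) (uE : separated_prime u E).
Hypothesis xE : forall f : {poly R}, f \is a polyOver E -> root f x -> f = 0.

Let F := subring_pred (adjoin_subring E x).

(** By transcendence a polynomial over [E] is determined by its value at [x]. Multiplying the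
    membership by [p ^+ a] clears [u], so [f = p ^+ a *: g] with [g] over [E]. *)
Lemma mem_adjoin_scale a (f : {poly R}) : f \is a polyOver E ->
  u ^+ a * f.[x] \in F -> u ^+ a *: f \is a polyOver E.
Proof.
move=> fE /set_mem[g gE fxg].
suff -> : u ^+ a *: f = g by [].
have -> : f = p ^+ a *: g.
  apply/eqP; rewrite -subr_eq0; apply/eqP/xE.
    by rewrite rpredB // polyOverZ // rpredX.
  apply/rootP; rewrite hornerD hornerN hornerZ -fxg mulrA -exprMn pu.
  by rewrite expr1n mul1r subrr.
by rewrite scalerA -exprMn mulrC pu expr1n scale1r.
Qed.

Lemma adjoin_pure : pure_in u E F.
Proof.
split=> [a aE|a aE]; first by apply/mem_set; exists a%:P; rewrite ?polyOverC ?hornerC.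
rewrite -(hornerC a x) -[u in u * _]expr1 => /mem_adjoin_scale.
rewrite polyOverC => /(_ aE)/polyOverP/(_ 0%N).
by rewrite hornerC coefZ coefC.
Qed.

(** Divisibility by [p] in [E[x]] is divisibility of all coefficients in [E]: primality is then
    Gauss' lemma, and separatedness is checked coefficient by coefficient. *)
Lemma adjoin_separated_prime : separated_prime u F.
Proof.
case: (uE) => uNE prE sepE; split.
- apply/negP; rewrite -[u]mulr1 => /(proj2 adjoin_pure _ (rpred1 _)).
  by rewrite mulr1; apply/negP.
- move=> _ _ /set_mem[f fE ->] /set_mem[g gE ->].
  rewrite -hornerM -[u in u * _]expr1 => /mem_adjoin_scale.
  rewrite rpredM // expr1 => /(_ isT)/(separated_prime_poly uE fE gE).
  case=> uE'; [left|right]; apply/mem_set.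
    by exists (u *: f); rewrite ?hornerZ.
  by exists (u *: g); rewrite ?hornerZ.
- move=> _ /set_mem[f fE ->] ufE; suff -> : f = 0 by rewrite horner0.
  apply/polyP => i; rewrite coef0; apply: sepE => [|n]; first exact/polyOverP.
  by rewrite -coefZ; apply/polyOverP/mem_adjoin_scale.
Qed.

End Transcendental.

(* The elements of [R] integral over the localization of [E] at [p], where
   [u = 1 / p]; [R] need not be a domain, so denominators are cleared. *)
Definition local_closure u E : set R :=
  [set r | exists c, [/\ c \in E, u * c \notin E & integral_over E (c * r)]].

Lemma integral_over_mem E x : x \in E -> integral_over E x.
Proof. by move=> xE; apply: (integral_id (val : subring_type E -> R) (Sub x xE)). Qed.

(** * The integral closure over the localization at [p] *)

Section LocalClosure.
Variables (p u : R) (E : subringClosed R).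
Hypotheses (pu : p * u = 1) (pE : p \in E) (uE : separated_prime u E).

Lemma mem_local_closure c r : c \in E -> u * c \notin E ->
  integral_over E (c * r) -> r \in local_closure u E.
Proof. by move=> *; apply/mem_set; exists c. Qed.

Lemma sub_local_closure : {subset E <= local_closure u E}.
Proof.
case: uE => uNE _ _ r rE; apply: (@mem_local_closure 1); rewrite ?rpred1 ?mulr1 //.
by rewrite mul1r; apply: integral_over_mem.
Qed.

Lemma local_closure_subring : is_subring (local_closure u E).
Proof.
have prE c d : c \in E -> u * c \notin E -> d \in E -> u * d \notin E ->
    c * d \in E /\ u * (c * d) \notin E.
  move=> cE ucE dE udE; split; first exact: rpredM.
  by apply/negP; case: uE => _ pr _ /(pr _ _ cE dE) []; apply/negP.
split=> [|r s|r s].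
- by apply: sub_local_closure; apply: rpred1.
- move=> /set_mem[c [cE ucE cr]] /set_mem[d [dE udE ds]].
  have [cdE ucdE] := prE _ _ cE ucE dE udE.
  apply: (mem_local_closure cdE ucdE).
  have -> : c * d * (r - s) = d * (c * r) - c * (d * s) by ring.
  by apply: integral_sub; apply: integral_mul => //; apply: integral_over_mem.
- move=> /set_mem[c [cE ucE cr]] /set_mem[d [dE udE ds]].
  have [cdE ucdE] := prE _ _ cE ucE dE udE.
  apply: (mem_local_closure cdE ucdE).
  by rewrite mulrACA; apply: integral_mul.
Qed.

(** A monic equation of degree [n + 1] for [c * u], multiplied by [p ^+ n], puts [u * c ^+ n.+1] in
    [E]. Then [p] divides a power of [c], hence [c] by primality. *)
Lemma notin_local_closure : u \notin local_closure u E.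
Proof.
apply/negP => /set_mem[c [cE ucE /integral_overP[f [fmon /polyOverP fE /rootP fcu]]]].
case fs : (size f) => [|n].
  by move: (monic_neq0 fmon); rewrite -size_poly_eq0 fs.
have fn : f`_n = 1 by rewrite -(monicP fmon) lead_coefE fs.
apply/negP: (separated_prime_expn uE n cE ucE).
move: fcu; rewrite horner_coef fs big_ord_recr /= fn mul1r => /eqP.
rewrite addrC addr_eq0 => /eqP cun.
(* In degree 0 the equation reads [1 = 0]. *)
case: n => [|n] in fs fn cun *.
  by move: cun; rewrite big_ord0 oppr0 => /eqP; rewrite expr0 oner_eq0.
have puX i : p ^+ i * u ^+ i = 1 by rewrite -exprMn pu expr1n.
have -> : u * c ^+ n.+1 = p ^+ n * (c * u) ^+ n.+1.
  transitivity (p ^+ n * u ^+ n * (u * c ^+ n.+1)); first by rewrite puX mul1r.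
  by rewrite exprMn !exprS; ring.
rewrite cun mulrN rpredN mulr_sumr rpred_sum // => -[i /= ltin] _.
rewrite exprMn -[in p ^+ n](@subnK i n) // exprD.
have -> : p ^+ (n - i) * p ^+ i * (f`_i * (c ^+ i * u ^+ i)) =
    p ^+ (n - i) * f`_i * c ^+ i * (p ^+ i * u ^+ i) by ring.
by rewrite puX mulr1 !rpredM ?rpredX.
Qed.

Lemma local_closure_inv q v :
  q \in E -> u * q \notin E -> q * v = 1 -> v \in local_closure u E.
Proof.
move=> qE uqE qv; apply: (mem_local_closure qE uqE).
by rewrite qv; apply/integral_over_mem/rpred1.
Qed.

(** Separatedness allows writing the leading coefficient as [c = p ^+ n * c'] with [c'] in [E] not
    divisible by [p]. Since [c * r] is integral and equals [c' * (p ^+ n * r)], the denominator [c']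
    works. *)
Lemma local_closure_algebraic (f : {poly R}) r :
  f \is a polyOver E -> f != 0 -> root f r ->
  exists n, p ^+ n * r \in local_closure u E.
Proof.
move=> fE f0 fr; set c := lead_coef f.
have cE : c \in E by apply/polyOverP.
have fs : (1 < size f)%N.
  rewrite ltnNge; apply: contra f0 => /size1_polyC fC; move: fr.
  by rewrite fC rootC => /eqP->.
have cr := integral_over_lead_coef fE fs fr.
have exn : exists n, u ^+ n * c \notin E.
  apply/not_existsP => ucE; move: f0; rewrite -lead_coef_eq0 => /eqP; apply.
  by case: uE => _ _; apply => // n; apply: contrapT => /negP/ucE.
(* The least exponent is not 0 because [c] is in [E]; its predecessor [n] is the exact power of [p]
   in [c]. *)
case: (ex_minnP exn) => -[|n] un nmin; first by rewrite mul1r cE in un.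
exists n; apply: (@mem_local_closure (u ^+ n * c)).
- by apply: contraT => /nmin; rewrite ltnn.
- by rewrite mulrA -exprS.
- by rewrite mulrACA -exprMn [u * p]mulrC pu expr1n mul1r.
Qed.

End LocalClosure.

End SubringPredicates.

(** * Zorn's lemma and the construction of maximal subrings *)

Lemma Zorn_above (T : Type) (P : set (set T)) (r : set T -> set T -> Prop)
    (S : set T) :
  (forall X, r X X) -> (forall X Y Z, r X Y -> r Y Z -> r X Z) ->
  (forall X Y, r X Y -> X `<=` Y) -> P S ->
  (forall F : set (set T), F !=set0 -> F `<=` P -> total_on F r ->
     P (\bigcup_(X in F) X) /\ forall X, F X -> r X (\bigcup_(X in F) X)) ->
  exists M, [/\ P M, r S M & forall N, P N -> r M N -> N = M].
Proof.
move=> rxx rtrans rsub PS chain.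
pose U := {X | P X /\ r S X}; pose le (X Y : U) := `[< r (sval X) (sval Y) >].
have [] := @ZL_preorder U (exist _ S (conj PS (rxx S))) le.
- by move=> X; apply/asboolP.
- by move=> X Y Z /asboolP XY /asboolP YZ; apply/asboolP; apply: rtrans YZ.
- move=> A totA; have [[X0 AX0]|A0] := pselect (A !=set0); last first.
    (* The empty chain is bounded by [S] itself. *)
    by exists (exist _ S (conj PS (rxx S))) => X AX; case: A0; exists X.
  pose F := [set sval X | X in A].
  have [| | |PF rF] := chain F.
  + by exists (sval X0), X0.
  + by move=> _ [X _ <-]; case: (svalP X).
  + move=> _ _ [X AX <-] [Y AY <-].
    by have [/asboolP|/asboolP] := totA _ _ AX AY; [left|right].
  have rA X : A X -> r (sval X) (\bigcup_(X in F) X) by move=> AX; apply: rF; exists X.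
  have rSF : r S (\bigcup_(X in F) X).
    by apply: rtrans (rA _ AX0); case: (svalP X0).
  by exists (exist _ (\bigcup_(X in F) X) (conj PF rSF) : U) => X /rA rX; apply/asboolP.
move=> [M [PM SM]] Mmax; exists M; split=> // N PN MN.
have /asboolP NM := Mmax (exist _ N (conj PN (rtrans _ _ _ SM MN))) (asboolT MN).
(* Antisymmetry of [r] comes from that of inclusion. *)
by apply/seteqP; split; apply: rsub.
Qed.

Section MaximalSubrings.
Variable R : comNzRingType.
Implicit Types (D E S : set R) (p q u v r x y : R).

Lemma bigcup_chain_subring (F : set (set R)) : F !=set0 ->
  (forall X, F X -> is_subring X) -> total_on F subset ->
  is_subring (\bigcup_(X in F) X).
Proof.
move=> [X0 FX0] Fsub Ftot.
have common x y : x \in \bigcup_(X in F) X -> y \in \bigcup_(X in F) X ->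
    exists X, [/\ F X, x \in X & y \in X].
  move=> /set_mem[X FX Xx] /set_mem[Y FY Yy].
  have [XY|YX] := Ftot _ _ FX FY.
    by exists Y; rewrite !inE; split=> //; apply: XY.
  by exists X; rewrite !inE; split=> //; apply: YX.
split=> [|x y xF yF|x y xF yF].
- by apply/mem_set; exists X0 => //; apply/set_mem; case: (Fsub _ FX0).
- have [X [FX xX yX]] := common _ _ xF yF; apply/mem_set; exists X => //.
  by case: (Fsub _ FX) => _ /(_ x y xX yX)/set_mem.
- have [X [FX xX yX]] := common _ _ xF yF; apply/mem_set; exists X => //.
  by case: (Fsub _ FX) => _ _ /(_ x y xX yX)/set_mem.
Qed.

(** Take [M] maximal among the subrings above [S] that avoid [u]. A strictly larger subring contains
    [u], hence every [r = u ^+ n * (p ^+ n * r)]. *)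
Lemma maximal_subring_above p u S : p * u = 1 -> is_subring S -> p \in S ->
  u \notin S -> (forall r, exists n, p ^+ n * r \in S) ->
  exists M, [/\ maximal_subring M, S `<=` M & u \notin M].
Proof.
move=> pu Sring pS uS pnS.
have [] := @Zorn_above _ [set T | is_subring T /\ u \notin T] subset S.
- by move=> X; apply: subset_refl.
- by move=> X Y Z; apply: subset_trans.
- by [].
- by [].
- move=> F F0 FP Ftot; split; last by move=> X FX; apply: bigcup_sup.
  split; first by apply: bigcup_chain_subring => // X /FP[].
  by apply/negP => /set_mem[X FX /mem_set]; apply/negP; case: (FP _ FX).
move=> M [[Mring uM] SM Mmax]; exists M; split=> //; split=> //.
  by apply/eqP => MT; case/negP: uM; apply/mem_set; rewrite MT.
move=> T Tring TT MT; have [uT|uT] := boolP (u \in T); last exact: Mmax.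
case/eqP: TT; apply/seteqP; split=> // r _; have [n pnr] := pnS r.
have -> : r = u ^+ n * (p ^+ n * r).
  by rewrite mulrA -exprMn mulrC [u * p]mulrC pu expr1n mulr1.
apply/set_mem/(@rpredM _ (subring_pred Tring)).
  exact: (@rpredX _ (subring_pred Tring)).
exact/mem_set/MT/SM/set_mem.
Qed.

Lemma exists_algebraic_extension p u D (Dring : is_subring D) :
  p * u = 1 -> p \in D -> separated_prime u (subring_pred Dring) ->
  exists E (Ering : is_subring E),
    [/\ pure_in u (subring_pred Dring) (subring_pred Ering),
        separated_prime u (subring_pred Ering)
      & forall x, exists f : {poly R},
          [/\ f \is a polyOver (subring_pred Ering), f != 0 & root f x]].
Proof.
move=> pu pD uD.
pose P E := exists Ering : is_subring E, separated_prime u (subring_pred Ering).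
pose pure E F := E `<=` F /\ forall a, E a -> F (u * a) -> E (u * a).
have [] := @Zorn_above _ P pure D.
- by move=> X; split.
- move=> X Y Z [XY pXY] [YZ pYZ]; split; first exact: subset_trans YZ.
  by move=> a Xa /pYZ => /(_ (XY _ Xa)); apply: pXY.
- by move=> X Y [].
- by exists Dring.
- move=> F [X0 FX0] FP Ftot; set G := \bigcup_(X in F) X.
  (* If [u * a] lies in a member [Y] of the chain, either [Y] is below [X], or [X] is pure in [Y];
     both give [u * a] in [X]. *)
  have Fcup X : F X -> pure X G.
    move=> FX; split=> [|a Xa [Y FY Yua]]; first exact: bigcup_sup.
    by have [[_]|[YX _]] := Ftot _ _ FX FY; [apply|apply: YX].
  have Fsub : total_on F subset.
    by move=> X Y FX FY; case: (Ftot _ _ FX FY) => -[]; [left|right].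
  have Gring : is_subring G.
    by apply: bigcup_chain_subring => //; [exists X0|move=> X /FP[]].
  split=> //; exists Gring; split.
  + apply/negP => /set_mem[X FX Xu]; have [Xring [/negP + _ _]] := FP _ FX.
    by apply; apply/mem_set.
  + move=> a b /set_mem[X FX Xa] /set_mem[Y FY Yb] /set_mem Guab.
    have [Z [FZ Za Zb]] : exists Z, [/\ F Z, Z a & Z b].
      by have [XY|YX] := Fsub _ _ FX FY; [exists Y|exists X]; split=> //; auto.
    have [Zring [_ prZ _]] := FP _ FZ.
    have Zuab : Z (u * (a * b)).
      apply: (proj2 (Fcup _ FZ)) Guab; apply/set_mem.
      by apply: (@rpredM _ (subring_pred Zring)); apply/mem_set.
    have ZG : Z `<=` G by case: (Fcup _ FZ).
    by case: (prZ a b (mem_set Za) (mem_set Zb) (mem_set Zuab)) => /set_mem/ZG/mem_set;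
      [left|right].
  + move=> a /set_mem[X FX Xa] Gua; have [Xring [_ _ sepX]] := FP _ FX.
    apply: sepX => [|n]; first exact/mem_set.
    (* Purity of [X] in the union brings the elements [u ^+ n * a] back into [X] one power at a
       time, so separatedness of [X] applies. *)
    elim: n => [|n IHn]; first by rewrite mul1r; apply/mem_set.
    rewrite exprS -mulrA; apply/mem_set/(proj2 (Fcup _ FX)); first exact/set_mem.
    by rewrite mulrA -exprS; apply/set_mem/Gua.
move=> E [[Ering uE] [DE DEpure] Emax]; exists E, Ering; split=> // [|x].
  split=> a /set_mem Da; first exact/mem_set/DE.
  by move=> /set_mem/(DEpure _ Da)/mem_set.
apply: contrapT => xalg.
have xE (f : {poly R}) : f \is a polyOver (subring_pred Ering) -> root f x -> f = 0.
  by move=> fE fx; apply: contrapT => /eqP f0; apply: xalg; exists f.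
have pE : p \in subring_pred Ering by apply/mem_set/DE/set_mem.
have [Esub Epure] := adjoin_pure pu pE xE.
have Eadj : adjoin (subring_pred Ering) x = E.
  apply: Emax; first by exists (adjoin_subring _ x); apply: adjoin_separated_prime pu pE uE xE.
  split=> a Ea; first exact/set_mem/Esub/mem_set.
  by move=> Fua; apply/set_mem/Epure; apply/mem_set.
(* Maximality puts [x] in [E], so ['X - x%:P] is a nonzero equation of [x] over [E]. *)
suff /eqP : 'X - x%:P = 0 :> {poly R} by rewrite polyXsubC_eq0.
apply: xE; last by rewrite root_XsubC.
rewrite rpredB ?polyOverX // polyOverC; apply/mem_set; rewrite -Eadj.
by exists 'X; rewrite ?polyOverX ?hornerX.
Qed.

(** Purity of [D] in the algebraic extension [E] ensures that an element of [D] not divisible by [p]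
    stays so in [E]; its inverse then lies in the local closure, hence in [M]. *)
Lemma maximal_subring_avoiding p u D (Dring : is_subring D) :
  p * u = 1 -> p \in D -> separated_prime u (subring_pred Dring) ->
  exists M, [/\ maximal_subring M, D `<=` M, u \notin M
    & forall q v, q \in D -> u * q \notin D -> q * v = 1 -> v \in M].
Proof.
move=> pu pD uD.
have [E [Ering [[DE DEpure] uE Ealg]]] := exists_algebraic_extension pu pD uD.
have pE : p \in subring_pred Ering by apply: DE.
pose S := local_closure u (subring_pred Ering).
have DS : {subset D <= S} by move=> a /DE; apply: sub_local_closure.
have [||||M [Mmax SM uM]] := @maximal_subring_above p u S pu.
- exact: local_closure_subring.
- exact: DS.
- exact: notin_local_closure pu pE uE.
- by move=> r; have [f [fE f0 fr]] := Ealg r; apply: local_closure_algebraic fE f0 fr.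
exists M; split=> // [a|q v qD uqD qv]; first by move/mem_set/DS/set_mem/SM.
apply/mem_set/SM/set_mem/(local_closure_inv _ _ qv); first exact: DE.
by apply: contra uqD; apply: DEpure.
Qed.

(** * Irreducible elements of a UFD are separated primes *)

Section UFD.
Variables (D : set R) (hD : is_UFD D).

Lemma UFD_subring : is_subring D. Proof. by case: hD. Qed.

Let P := subring_pred UFD_subring.

Lemma units_ofM x y : x \in units_of D -> y \in units_of D ->
  x * y \in units_of D.
Proof.
move=> /set_mem[xD [x' x'D xx']] /set_mem[yD [y' y'D yy']]; apply/mem_set; split.
  exact: (@rpredM _ P).
by exists (x' * y'); [apply: (@rpredM _ P)|rewrite mulrACA xx' yy' mulr1].
Qed.

Lemma units_of_inv x y : x \in D -> y \in D -> x * y = 1 -> x \in units_of D.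
Proof. by move=> xD yD xy; apply/mem_set; split=> //; exists y. Qed.

Lemma units_of_sub x : x \in units_of D -> x \in D.
Proof. by move=> /set_mem[]. Qed.

Lemma units_of_divl x y : x \in D -> y \in D -> x * y \in units_of D ->
  x \in units_of D.
Proof.
move=> xD yD /set_mem[_ [z zD xyz]]; apply: (@units_of_inv _ (y * z)) => //.
  exact: (@rpredM _ P).
by rewrite mulrA.
Qed.

Lemma irreducible_unitM v p : v \in units_of D -> p \in irreducibles D ->
  v * p \in irreducibles D.
Proof.
move=> vU; have vD := units_of_sub vU; move: vU => /set_mem[_ [w wD vw]].
move=> /set_mem[pD p0 pU pirr].
have wvp : p = w * (v * p) by rewrite mulrA [w * v]mulrC vw mul1r.
have wU : w \in units_of D by apply: (@units_of_inv _ v) => //; rewrite mulrC.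
have vpD : v * p \in D by apply: (@rpredM _ P).
apply/mem_set; split=> //.
- by apply: contraNneq p0 => vp0; rewrite wvp vp0 mulr0.
- by apply: contra pU => vpU; rewrite wvp; apply: units_ofM.
move=> x y xD yD vpxy; have wxD : w * x \in D by apply: (@rpredM _ P).
have [|wxU|] := pirr (w * x) y wxD yD; first by rewrite wvp vpxy mulrA.
  by left; apply: (@units_of_divl _ w); rewrite // mulrC.
by right.
Qed.

(** The unit [v] lets units of [D] be treated together with the other nonzero elements. *)
Lemma UFD_factor x : x \in D -> x != 0 ->
  exists v (s : seq R), [/\ v \in units_of D, {subset s <= irreducibles D}
    & x = v * \prod_(q <- s) q].
Proof.
move=> xD x0; have [xU|xU] := boolP (x \in units_of D).
  by exists x, [::]; rewrite big_nil mulr1.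
have [_ _ /(_ x xD x0 xU) [s sI ->] _] := hD.
exists 1, s; rewrite mul1r; split=> //.
by apply: (@units_of_inv _ 1); rewrite ?mulr1 //; apply: (@rpred1 _ P).
Qed.

(** All the units are absorbed into the factor [p], so that unique factorization, which concerns
    bare products of irreducibles, applies. *)
Lemma prod_irreducibles_perm (v w : R) (s t : seq R) (p : R) :
  v \in units_of D -> w \in units_of D -> p \in irreducibles D ->
  {subset s <= irreducibles D} -> {subset t <= irreducibles D} ->
  p * (v * \prod_(q <- s) q) = w * \prod_(q <- t) q ->
  size t = (size s).+1 /\ exists2 q, q \in t & associate D p q.
Proof.
move=> vU wU pI sI tI pst.
have [w' [w'D ww']] : exists w', w' \in D /\ w * w' = 1.
  by move: wU => /set_mem[_ [w' w'D ww']]; exists w'.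
have wD := units_of_sub wU.
have w'U : w' \in units_of D by apply: (@units_of_inv _ w) => //; rewrite mulrC.
have w'vU := units_ofM w'U vU.
have w'vpI := irreducible_unitM w'vU pI.
have [_ _ _ uniqD] := hD.
have [|||t' [tt' sz ass]] := uniqD (w' * v * p :: s) t.
- by move=> q; rewrite inE => /predU1P[->|/sI].
- by [].
- rewrite big_cons; transitivity (w' * (p * (v * \prod_(q <- s) q))); first by ring.
  by rewrite pst mulrA [w' * w]mulrC ww' mul1r.
rewrite (perm_size tt') -sz; split=> //; exists t'`_0.
  by rewrite (perm_mem tt') mem_nth -?sz.
have [//|a aU ->] := ass 0%N.
by exists (a * (w' * v)); [apply: units_ofM|rewrite /= mulrA].
Qed.

(** Primality: [p] is associate to a factor of [a * b], hence to one of [a] or of [b].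
    Separatedness: [a] cannot be divisible by more powers of [p] than it has irreducible factors. *)
Lemma UFD_separated_prime p u : p \in irreducibles D -> p * u = 1 ->
  separated_prime u P.
Proof.
move=> pI pu; have /set_mem[pD p0 pU _] := pI.
have u_div a : u * a = 0 -> a = 0.
  by move=> ua0; rewrite -[a]mul1r -pu -mulrA ua0 mulr0.
have [_ intD _ _] := hD.
split=> [|a b aD bD uabD|a aD uaD].
- by apply: contra pU => uD; apply: units_of_inv pu.
- have [->|a0] := eqVneq a 0; first by left; rewrite mulr0; apply: (@rpred0 _ P).
  have [->|b0] := eqVneq b 0; first by right; rewrite mulr0; apply: (@rpred0 _ P).
  have uab0 : u * (a * b) != 0.
    by apply/eqP => /u_div/(intD _ _ aD bD)[] /eqP; apply/negP.
  have [v [s [vU sI uabE]]] := UFD_factor uabD uab0.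
  have [w [t [wU tI aE]]] := UFD_factor aD a0.
  have [z [r [zU rI bE]]] := UFD_factor bD b0.
  have trI : {subset t ++ r <= irreducibles D}.
    by move=> q; rewrite mem_cat => /orP[/tI|/rI].
  have [|_ [q]] := prod_irreducibles_perm vU (units_ofM wU zU) pI sI trI.
    by rewrite -uabE big_cat /= mulrA pu mul1r aE bE; ring.
  have div x c l : c \in units_of D -> {subset l <= irreducibles D} ->
      x = c * \prod_(q <- l) q -> q \in l -> associate D p q -> u * x \in P.
    move=> cU lI -> ql [d dU qE]; rewrite (big_rem q) //= qE.
    rewrite (_ : u * _ = p * u * (c * d * \prod_(y <- rem (d * p) l) y)); last by ring.
    rewrite pu mul1r big_seq; apply: (@rpredM _ P).
      by apply: (@rpredM _ P); apply: units_of_sub.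
    by apply: (@rpred_prod _ P) => y /mem_rem/lI/set_mem[].
  rewrite mem_cat => /orP[qt|qr] pq; [left|right].
    exact: div wU tI aE qt pq.
  exact: div zU rI bE qr pq.
- have [//|a0] := eqVneq a 0.
  have [v [s [vU sI aE]]] := UFD_factor aD a0.
  have uXa0 : u ^+ (size s).+1 * a != 0.
    apply: contra_neq a0; elim: (size s).+1 => [|n IHn]; first by rewrite mul1r.
    by rewrite exprS -mulrA => /u_div.
  have [w [t [wU tI uaE]]] := UFD_factor (uaD (size s).+1) uXa0.
  (* Only [size s] of the [(size s).+1] copies of [p] are listed: the remaining one is the isolated
     factor in [prod_irreducibles_perm]. *)
  have ptI : {subset nseq (size s) p ++ t <= irreducibles D}.
    by move=> q; rewrite mem_cat => /orP[/nseqP[->]|/tI].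
  have [|sz _] := prod_irreducibles_perm wU vU pI ptI sI.
    rewrite -aE big_cat /= big_nseq iter_mulr_1.
    transitivity (p ^+ (size s).+1 * (w * \prod_(q <- t) q)).
      by rewrite exprS; ring.
    by rewrite -uaE mulrA -exprMn pu expr1n mul1r.
  have : (size s < size s)%N by rewrite {2}sz size_cat size_nseq ltnS leq_addr.
  by rewrite ltnn.
Qed.

End UFD.

End MaximalSubrings.

(** * Distinguishing the maximal subrings *)

Section NonIsomorphic.
Variable R : comNzRingType.
Implicit Types (D I S T : set R) (p q u v x y : R).

(** From [q = p * (u * q)] with [q] irreducible and [p] not a unit of [D], the cofactor is a unit;
    thus [p] and [q] both represent the class of [q]. *)
Lemma Irr_nondivisor D I p q u : is_UFD D -> is_Irr D I -> p \in I -> q \in I ->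
  p * u = 1 -> u * q \in D -> p = q.
Proof.
move=> hD [Isub Iuniq] pI qI pu uqD; have Dring := UFD_subring hD.
have /set_mem[pD _ pU _] : p \in irreducibles D by apply/mem_set/Isub/set_mem.
have qirr : q \in irreducibles D by apply/mem_set/Isub/set_mem.
have /set_mem[qD _ _ qfac] := qirr.
have [r [_ runiq]] := Iuniq q qirr.
have quqp : q = p * (u * q) by rewrite mulrA pu mul1r.
have [pU'|uqU] := qfac _ _ pD uqD quqp; first by rewrite pU' in pU.
have /set_mem[_ [w wD uqw]] := uqU.
have <- : r = q.
  apply: runiq; split=> //; exists 1; rewrite ?mul1r //.
  by apply: (@units_of_inv _ D 1 1); rewrite ?mulr1 //; case: Dring.
apply/esym/runiq; split=> //; exists w.
  by apply: (@units_of_inv _ D w (u * q)); rewrite // mulrC.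
by rewrite quqp mulrCA [w * _]mulrC uqw mulr1.
Qed.

(** The isomorphism fixes [q], so it sends [v] to an inverse of [q], which can only be [v]. *)
Lemma alg_isomorphic_inv D S T q v : alg_isomorphic D S T ->
  D `<=` S -> q \in D -> v \in S -> q * v = 1 -> v \in T.
Proof.
move=> [f [[fST _ _] _ fM f1 fD]] DS qD vS qv.
have qS : q \in S by apply/mem_set/DS/set_mem.
have qfv : q * f v = 1 by rewrite -{1}(fD _ qD) -fM // qv.
suff -> : v = f v by apply/mem_set/fST/set_mem.
by rewrite -[f v]mul1r -qv mulrAC qfv mul1r.
Qed.

End NonIsomorphic.

Theorem theorem3p9 (R : comNzRingType) (D : set R) (hD : is_UFD D)
    (IrrD : set R) (hIrr : is_Irr D IrrD) :
  exists F : set (set R),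
    [/\ forall S : set R, F S -> maximal_subring S /\ D `<=` S,
        forall S T : set R, F S -> F T -> alg_isomorphic D S T -> S = T
      & (units_of [set: R] `&` IrrD #<= F)%card].
Proof.
set A := units_of [set: R] `&` IrrD.
have AD p : A p -> p \in D.
  by move=> [_ /(proj1 hIrr)[]].
have Ainv p : A p -> exists u, p * u = 1 by move=> [[_ [u _ pu]] _]; exists u.
(* The condition [A p] sits under the existential so that [choice] yields a function on all of [R];
   its values off [A] are arbitrary. *)
have exM p : exists M, A p -> [/\ maximal_subring M, D `<=` M,
    forall u, p * u = 1 -> u \notin M
  & forall q v, A q -> p <> q -> q * v = 1 -> v \in M].
  have [Ap|nAp] := pselect (A p); last by exists setT.
  have [u pu] := Ainv p Ap.
  have pI : p \in irreducibles D.
    by apply/mem_set/(proj1 hIrr); case: Ap.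
  have [M [Mmax DM uM invM]] :=
    maximal_subring_avoiding pu (AD p Ap) (UFD_separated_prime hD pI pu).
  exists M => _; split=> // [u' pu'|q v Aq pq qv].
    by rewrite -[u']mul1r -pu mulrAC pu' mul1r.
  apply: (invM q v) => //; first exact: AD.
  apply/negP => uqD; apply: pq; apply: Irr_nondivisor hD hIrr _ _ pu uqD.
    by apply/mem_set; case: Ap.
  by apply/mem_set; case: Aq.
have /choice[M hM] := exM.
have iso_eq p q : A p -> A q -> alg_isomorphic D (M p) (M q) -> p = q.
  move=> Ap Aq iso; apply: contrapT => pq; have [v qv] := Ainv q Aq.
  have [_ DMp _ /(_ q v Aq pq qv) vMp] := hM p Ap.
  have [_ _ /(_ v qv)/negP + _] := hM q Aq; apply.
  exact: alg_isomorphic_inv iso DMp (AD q Aq) vMp qv.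
exists (M @` A); split.
- by move=> _ [p Ap <-]; have [] := hM p Ap.
- by move=> _ _ [p Ap <-] [q Aq <-] /(iso_eq p q Ap Aq)->.
- suff /card_eqPle[] : (M @` A #= A)%card by [].
  apply: inj_card_eq => p q /set_mem Ap /set_mem Aq Mpq.
  (* Equal subrings are isomorphic through the identity, so non-isomorphism already gives
     injectivity of [M] on [A]. *)
  apply: iso_eq => //; rewrite Mpq; exists id; split=> //.
  by split=> // x Mx; exists x.
Qed.
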